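(* Let $r\ge2$ be an integer. For every partition $\nu=(\nu_1,\ldots,\nu_d)\vdash r-1$, $$C_\nu=\lim_{t\uparrow1}\ \frac{1}{\prod_{j=1}^d(\nu_j+1)!}\sum_{\sigma\in\operatorname{Perm}(\nu)}\ \sum_{m_1,\ldots,m_d\ge0}(-t)^{m_1+\cdots+m_d}\,\zeta\bigl(\nu_{\sigma(1)}+1+m_1,\ldots,\nu_{\sigma(d)}+1+m_d\bigr).$$ In particular, the length $d=\ell(\nu)$ is the depth of every multiple zeta value occurring in the block associated with $\nu$.
   Context: $\nu\vdash N$ means that $\nu$ is a partition (into positive parts) of $N$; $\ell(\nu)$ is its number of parts. $\operatorname{Perm}(\nu)$ denotes the set of distinct permutations of the parts of $\nu$, i.e. the set of distinct rearrangements $(\nu_{\sigma(1)},\ldots,\nu_{\sigma(d)})$ of the tuple $(\nu_1,\ldots,\nu_d)$, each counted once. Multiple zeta values use the ascending-index convention $$\zeta(s_1,\ldots,s_d)=\sum_{1\le q_1<\cdots<q_d}\frac{1}{q_1^{s_1}\cdots q_d^{s_d}},$$ and $d$ is called the depth. For $k,q\ge1$ put $a_k(q)=\dfrac{1}{(k+1)!\,q^k(q+1)}$. With $m_j(\nu)$ the multiplicity of the part $j$ in $\nu$, $$C_\nu=\frac{1}{\prod_{j\ge1}m_j(\nu)!}\sum_{\substack{q_1,\ldots,q_d\ge1\\ q_a\ne q_b\ (a\ne b)}}\ \prod_{s=1}^d a_{\nu_s}(q_s),$$ an absolutely convergent sum over ordered $d$-tuples of distinct positive integers. The limit is in the Abel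 sense: the inner series is considered for $0\le t<1$ and then $t\uparrow1$; no convergence of the series at $t=1$ is asserted. *)

(* Defs.v *)
From HB Require Import structures.
From mathcomp Require Import all_boot all_order all_algebra.
From mathcomp Require Import all_classical all_reals all_analysis.

Set Implicit Arguments.
Unset Strict Implicit.
Unset Printing Implicit Defensive.

Import Order.TTheory GRing.Theory Num.Theory.
Import numFieldNormedType.Exports.

Local Open Scope classical_set_scope.
Local Open Scope ring_scope.

(* A partition is listed in nonincreasing order. *)
Definition is_partition (N : nat) (nu : seq nat) : bool :=
  [&& sorted geq nu, all (leq 1%N) nu & sumn nu == N].

(* Absolute convergence of the family (f x), x in D, and its sum.  The library
   only sums nonnegative families over a set, so the sum of a signed family is
   the difference of the sums of its positive and negative parts; [sum_over]
   is meaningful only for absolutely summable families. *)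
Definition abs_summable (R : realType) (T : choiceType) (D : set T)
    (f : T -> R) : Prop := summable D (EFin \o f).

Definition sum_over (R : realType) (T : choiceType) (D : set T)
    (f : T -> R) : R :=
  fine (esum D (EFin \o f)^\+ - esum D (EFin \o f)^\-)%E.

(* The index word is s; [path ltn 0 q] means 0 < q_1 < ... < q_d. *)
Definition mzv_dom (s : seq nat) : set ((size s).-tuple nat) :=
  [set q | path ltn 0%N q].

Definition mzv_term (R : realType) (s : seq nat) (q : (size s).-tuple nat) : R :=
  \prod_(i < size s) ((tnth q i)%:R ^+ tnth (in_tuple s) i)^-1.

Definition mzv (R : realType) (s : seq nat) : R :=
  sum_over (@mzv_dom s) (@mzv_term R s).

Definition mzv_depth (s : seq nat) : nat := size s.

Definition a_coef (R : realType) (k q : nat) : R :=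
  ((k.+1)`!%:R * q%:R ^+ k * q.+1%:R)^-1.

Definition C_dom (nu : seq nat) : set ((size nu).-tuple nat) :=
  [set q | all (leq 1%N) q && uniq q].

Definition C_term (R : realType) (nu : seq nat) (q : (size nu).-tuple nat) : R :=
  \prod_(i < size nu) a_coef R (tnth (in_tuple nu) i) (tnth q i).

(* Parts larger than [sumn nu] have multiplicity 0 and contribute a factor 1. *)
Definition C_part (R : realType) (nu : seq nat) : R :=
  ((\prod_(1 <= j < (sumn nu).+1) (count_mem j nu)`!)%N%:R)^-1 *
  sum_over (@C_dom nu) (@C_term R nu).

(* The word (sigma_1 + 1 + m_1, ..., sigma_d + 1 + m_d). *)
Definition shift_word (sigma m : seq nat) : seq nat :=
  [seq (p.1 + 1 + p.2)%N | p <- zip sigma m].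

Definition block_term (R : realType) (nu sigma : seq nat) (t : R)
    (m : (size nu).-tuple nat) : R :=
  (- t) ^+ sumn m * mzv R (shift_word sigma m).

Definition block (R : realType) (nu : seq nat) (t : R) : R :=
  ((\prod_(k <- nu) (k.+1)`!)%N%:R)^-1 *
  \sum_(sigma <- permutations nu) sum_over setT (@block_term R nu sigma t).

Definition block_words (nu : seq nat) : set (seq nat) :=
  [set w | exists2 sigma : seq nat, sigma \in permutations nu &
           exists m : (size nu).-tuple nat, w = shift_word sigma m].

(* Main.v *)
Require Import Defs.
From HB Require Import structures.
From mathcomp Require Import all_boot all_order all_algebra.
From mathcomp Require Import all_classical all_reals all_analysis.
From mathcomp Require Import ring lra zify.

Set Implicit Arguments.
Unset Strict Implicit.
Unset Printing Implicit Defensive.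

Import Order.TTheory GRing.Theory Num.Theory.
Import numFieldNormedType.Exports.

Local Open Scope classical_set_scope.
Local Open Scope ring_scope.

(** Write each zeta value as a sum over 1 <= q_1 < ... < q_d. For 0 <= t < 1
    the double series over m and q converges absolutely, and summing first over
    m gives geometric series: with s_i the parts of the arrangement sigma, the
    inner series of sigma equals

      L_sigma(t) = sum over q_1 < ... < q_d of prod_i 1/(q_i^s_i (q_i + t)).

    This is [block_sum]. The right-hand side makes sense at t = 1, and because
    1 <= (q + 1)/(q + t) <= 2/(1 + t) for every q >= 1, it satisfies
    L_sigma(1) <= L_sigma(t) <= (2/(1 + t))^d L_sigma(1). Hence L_sigma(t)
    tends to L_sigma(1) as t increases to 1 ([cvg_resummed_sum]), and the block
    tends to the sum of the L_sigma(1), divided by prod_j (nu_j + 1)!.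

    On the other side, the factors a_k(q) are 1/(q^k (q + 1)) up to 1/(k+1)!.
    Sorting a tuple of distinct integers turns the sum defining C_nu into a sum
    over increasing tuples and over all d! ways of matching the parts of nu
    with their entries; each distinct arrangement sigma of nu arises prod_j m_j!
    times, which the normalisation of C_nu cancels ([sum_permutations_swap],
    [C_part_sum]). What remains is the same sum of the L_sigma(1). *)

(** * Absolutely summable signed families *)

(** The value of [sum_over] says nothing about a family that is not
    absolutely summable, so the two facts are always carried together. *)
Definition has_sum (R : realType) (T : choiceType) (D : set T) (f : T -> R)
    (S : R) : Prop :=
  abs_summable D f /\ sum_over D f = S.

Lemma maxr0_ge0 (R : realDomainType) (x : R) : 0 <= Num.max x 0.
Proof. by rewrite le_max lexx orbT. Qed.

Lemma maxr0_subN (R : realFieldType) (x : R) :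
  x = Num.max x 0 - Num.max (- x) 0.
Proof. by rewrite !maxr_absE !subr0 normrN; field. Qed.

(** A signed sum may be computed from any splitting into two nonnegative
    summable families, not only from its positive and negative parts. Scalar
    multiples, products and iterated sums are all obtained by exhibiting one. *)
Lemma has_sum_decomp (R : realType) (T : choiceType) (D : set T)
    (f g h : T -> R) (A B : R) :
    (forall x, D x -> 0 <= g x) -> (forall x, D x -> 0 <= h x) ->
    (forall x, D x -> f x = g x - h x) ->
    \esum_(x in D) (g x)%:E = A%:E -> \esum_(x in D) (h x)%:E = B%:E ->
  has_sum D f (A - B).
Proof.
move=> g0 h0 fE gA hB.
have sg : summable D (EFin \o g).
  rewrite /summable (eq_esum (b := fun x => (g x)%:E)) ?gA ?ltry// => x Dx.
  by rewrite gee0_abs// lee_fin g0.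
have sh : summable D (EFin \o h).
  rewrite /summable (eq_esum (b := fun x => (h x)%:E)) ?hB ?ltry// => x Dx.
  by rewrite gee0_abs// lee_fin h0.
have fE' x : D x -> ((EFin \o f) x = ((EFin \o g) \- (EFin \o h)) x)%E.
  by move=> Dx /=; rewrite fE.
split.
  have := summableB sg sh; rewrite /abs_summable /summable.
  rewrite -(eq_esum (a := fun x => `|(EFin \o f) x|%E))// => x Dx.
  by rewrite fE'.
rewrite /sum_over.
have -> : esum D ((EFin \o f)^\+)%E =
    esum D (((EFin \o g) \- (EFin \o h))^\+)%E.
  by apply: eq_esum => x Dx; rewrite !funeposE fE'.
have -> : esum D ((EFin \o f)^\-)%E =
    esum D (((EFin \o g) \- (EFin \o h))^\-)%E.
  by apply: eq_esum => x Dx; rewrite !funenegE fE'.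
rewrite esumB//; do ?by move=> x Dx; rewrite lee_fin ?g0 ?h0.
by rewrite gA hB.
Qed.

Lemma has_sumP (R : realType) (T : choiceType) (D : set T) (f : T -> R)
    (S : R) :
  has_sum D f S ->
  exists2 AB : R * R, S = AB.1 - AB.2 &
    \esum_(x in D) (Num.max (f x) 0)%:E = AB.1%:E /\
    \esum_(x in D) (Num.max (- f x) 0)%:E = AB.2%:E.
Proof.
move=> [sf fS].
have posE : esum D ((EFin \o f)^\+)%E = \esum_(x in D) (Num.max (f x) 0)%:E.
  by apply: eq_esum => x _; rewrite funeposE /= EFin_max.
have negE : esum D ((EFin \o f)^\-)%E = \esum_(x in D) (Num.max (- f x) 0)%:E.
  by apply: eq_esum => x _; rewrite funenegE /= EFin_max.
have fp : \esum_(x in D) (Num.max (f x) 0)%:E \is a fin_num.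
  rewrite ge0_fin_numE; last first.
    by apply: esum_ge0 => x _; rewrite lee_fin maxr0_ge0.
  apply: le_lt_trans sf; apply: le_esum => x _ /=.
  by rewrite lee_fin ge_max normr_ge0 ler_norm.
have fn : \esum_(x in D) (Num.max (- f x) 0)%:E \is a fin_num.
  rewrite ge0_fin_numE; last first.
    by apply: esum_ge0 => x _; rewrite lee_fin maxr0_ge0.
  apply: le_lt_trans sf; apply: le_esum => x _ /=.
  by rewrite lee_fin ge_max normr_ge0 -normrN ler_norm.
exists (fine (\esum_(x in D) (Num.max (f x) 0)%:E),
        fine (\esum_(x in D) (Num.max (- f x) 0)%:E)); last by rewrite !fineK.
by rewrite -fS /sum_over posE negE fineB.
Qed.

(** The bridge between signed sums and the sums of nonnegative families,
    for which rearrangement is unconditional. *)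
Lemma has_sum_ge0 (R : realType) (T : choiceType) (D : set T) (f : T -> R)
    (S : R) : (forall x, D x -> 0 <= f x) ->
  has_sum D f S <-> \esum_(x in D) (f x)%:E = S%:E.
Proof.
move=> f0; split=> [/has_sumP[[A B] /= -> /= [fA fB]]|fS].
  have -> : B = 0.
    apply: EFin_inj; rewrite -fB esum1// => x Dx; congr EFin; apply/max_idPr.
    by rewrite oppr_le0 f0.
  rewrite subr0 -fA; apply: eq_esum => x Dx; congr EFin; apply/esym/max_idPl.
  exact: f0.
rewrite -[S]subr0; apply: (has_sum_decomp (g := f) (h := fun=> 0)) => //.
  by move=> x _; rewrite subr0.
by rewrite esum1.
Qed.

Lemma abs_summable_has_sum (R : realType) (T : choiceType) (D : set T)
    (f : T -> R) : abs_summable D f -> has_sum D f (sum_over D f).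
Proof. by []. Qed.

Lemma abs_summable_le (R : realType) (T : choiceType) (D : set T)
    (f g : T -> R) : (forall x, D x -> `|f x| <= g x) ->
  abs_summable D g -> abs_summable D f.
Proof.
move=> fg; apply: le_lt_trans; apply: le_esum => x Dx /=.
by rewrite lee_fin (le_trans (fg _ Dx))// ler_norm.
Qed.

Lemma sub_abs_summable (R : realType) (T : choiceType) (D E : set T)
    (f : T -> R) : D `<=` E -> abs_summable E f -> abs_summable D f.
Proof.
move=> DE; apply: le_lt_trans; rewrite (esum_mkcond D) (esum_mkcond E).
apply: le_esum => x _; case: ifPn => [/set_mem/DE/mem_set ->//|_].
by case: ifP.
Qed.

Lemma eq_has_sum (R : realType) (T : choiceType) (D : set T) (f g : T -> R)
    (S : R) : (forall x, D x -> f x = g x) -> has_sum D f S -> has_sum D g S.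
Proof.
move=> fg [sf fS]; split.
  apply: (abs_summable_le (g := fun x => `|f x|)) => [x Dx|].
    by rewrite fg.
  move: sf; apply: le_lt_trans; apply: le_esum => x Dx /=.
  by rewrite normr_id.
rewrite -fS /sum_over; congr (fine (_ - _)).
  by apply: eq_esum => x Dx; rewrite !funeposE /= fg.
by apply: eq_esum => x Dx; rewrite !funenegE /= fg.
Qed.

Lemma has_sum_reindex (R : realType) (T U : choiceType) (D : set T) (E : set U)
    (e : T -> U) (f : U -> R) (S : R) : set_bij D E e ->
  has_sum D (f \o e) S <-> has_sum E f S.
Proof.
move=> be.
rewrite /has_sum /abs_summable /summable (reindex_esum D E e)//.
suff -> : sum_over E f = sum_over D (f \o e) by [].
rewrite /sum_over; congr (fine (_ - _)); rewrite (reindex_esum D E e)//.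
  by apply: eq_esum => x _; rewrite !funeposE.
by apply: eq_esum => x _; rewrite !funenegE.
Qed.

Lemma has_sum_le (R : realType) (T : choiceType) (D : set T) (f g : T -> R)
    (A B : R) : (forall x, D x -> 0 <= f x <= g x) ->
  has_sum D f A -> has_sum D g B -> A <= B.
Proof.
move=> fg fA gB; rewrite -lee_fin.
have f0 x : D x -> 0 <= f x by move=> /fg/andP[].
have g0 x : D x -> 0 <= g x by move=> /fg/andP[]; exact: le_trans.
rewrite -(proj1 (has_sum_ge0 _ f0) fA) -(proj1 (has_sum_ge0 _ g0) gB).
by apply: le_esum => x /fg/andP[_]; rewrite lee_fin.
Qed.

Lemma esum_mull_le (R : realType) (T : choiceType) (D : set T) (f : T -> R)
    (c : R) : 0 <= c ->
  (\esum_(x in D) (c * f x)%:E <= c%:E * \esum_(x in D) (f x)%:E)%E.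
Proof.
move=> c0; apply: ge_ereal_sup => _ [X [finX XD]] <-.
rewrite fsbig_finite//= sumEFin -mulr_sumr EFinM -sumEFin.
apply: lee_wpmul2l; first by rewrite lee_fin.
rewrite -fsbig_finite//; apply: esum_ge; exists X => //.
Qed.

Lemma esum_mull (R : realType) (T : choiceType) (D : set T) (f : T -> R)
    (c : R) : 0 <= c ->
  (\esum_(x in D) (c * f x)%:E = c%:E * \esum_(x in D) (f x)%:E)%E.
Proof.
move=> c0; apply/eqP; rewrite eq_le esum_mull_le//=.
have [->|cn0] := eqVneq c 0.
  by rewrite mul0e esum_ge0// => x _; rewrite mul0r.
have ci0 : 0 <= c^-1 by rewrite invr_ge0.
have := esum_mull_le D (fun x => c * f x) ci0.
under eq_esum do rewrite mulKf//.
(* The converse inequality is the same one for the scalar 1/c. *)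
move=> /(@lee_wpmul2l _ c%:E _)/le_trans; apply; first by rewrite lee_fin.
by rewrite muleA -EFinM mulfV// mul1e.
Qed.

Lemma has_sum_mull (R : realType) (T : choiceType) (D : set T) (f : T -> R)
    (c S : R) : has_sum D f S -> has_sum D (fun x => c * f x) (c * S).
Proof.
move=> /has_sumP[[A B] /= -> /= [fA fB]].
have [c0|/ltW c0] := leP 0 c.
  rewrite mulrBr; apply: (has_sum_decomp
    (g := fun x => c * Num.max (f x) 0) (h := fun x => c * Num.max (- f x) 0)).
  - by move=> x _; rewrite mulr_ge0// maxr0_ge0.
  - by move=> x _; rewrite mulr_ge0// maxr0_ge0.
  - by move=> x _; rewrite {1}(maxr0_subN (f x)) mulrBr.
  - by rewrite esum_mull// fA.
  - by rewrite esum_mull// fB.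
have nc0 : 0 <= - c by rewrite oppr_ge0.
have -> : c * (A - B) = - c * B - (- c * A) by ring.
apply: (has_sum_decomp
  (g := fun x => - c * Num.max (- f x) 0)
  (h := fun x => - c * Num.max (f x) 0)).
- by move=> x _; rewrite mulr_ge0// maxr0_ge0.
- by move=> x _; rewrite mulr_ge0// maxr0_ge0.
- by move=> x _; rewrite {1}(maxr0_subN (f x)); ring.
- by rewrite esum_mull// fB.
- by rewrite esum_mull// fA.
Qed.

(** Writing f = f+ - f- and g = g+ - g-, the product f g is the difference
    of f+ g+ + f- g- and f+ g- + f- g+, so the nonnegative case suffices. *)
Lemma has_sum_prod (R : realType) (T U : choiceType) (D : set T) (E : set U)
    (f : T -> R) (g : U -> R) (A B : R) :
  has_sum D f A -> has_sum E g B ->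
  has_sum (D `*` E) (fun x => f x.1 * g x.2) (A * B).
Proof.
have prod_ge0 (u : T -> R) (v : U -> R) (a b : R) :
    (forall x, 0 <= u x) -> (forall y, 0 <= v y) ->
    \esum_(x in D) (u x)%:E = a%:E -> \esum_(y in E) (v y)%:E = b%:E ->
    \esum_(x in D `*` E) (u x.1 * v x.2)%:E = (a * b)%:E.
  move=> u0 v0 ua vb.
  have b0 : 0 <= b by rewrite -lee_fin -vb esum_ge0// => y _; rewrite lee_fin.
  rewrite -(@esum_esum _ _ _ D (fun=> E) (fun x y => (u x * v y)%:E)); last first.
    by move=> x y _ _; rewrite lee_fin mulr_ge0.
  rewrite mulrC EFinM -ua -esum_mull//; apply: eq_esum => x _.
  by rewrite esum_mull// vb -EFinM mulrC.
move=> /has_sumP[[A1 A2] /= -> /= [fA1 fA2]].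
move=> /has_sumP[[B1 B2] /= -> /= [gB1 gB2]].
pose fp x := Num.max (f x) 0; pose fn x := Num.max (- f x) 0.
pose gp x := Num.max (g x) 0; pose gn x := Num.max (- g x) 0.
have fp0 x : 0 <= fp x by exact: maxr0_ge0.
have fn0 x : 0 <= fn x by exact: maxr0_ge0.
have gp0 x : 0 <= gp x by exact: maxr0_ge0.
have gn0 x : 0 <= gn x by exact: maxr0_ge0.
have -> : (A1 - A2) * (B1 - B2) = (A1 * B1 + A2 * B2) - (A1 * B2 + A2 * B1).
  by ring.
apply: (has_sum_decomp (g := fun x => fp x.1 * gp x.2 + fn x.1 * gn x.2)
                       (h := fun x => fp x.1 * gn x.2 + fn x.1 * gp x.2)).
- by move=> x _; rewrite addr_ge0// mulr_ge0.
- by move=> x _; rewrite addr_ge0// mulr_ge0.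
- move=> x _; rewrite {1}(maxr0_subN (f x.1)) {1}(maxr0_subN (g x.2)) -/(fp _) -/(fn _).
  by rewrite -/(gp _) -/(gn _); ring.
- under eq_esum do rewrite EFinD.
  rewrite esumD; [|by move=> x _; rewrite lee_fin mulr_ge0..].
  by rewrite (prod_ge0 fp gp A1 B1)// (prod_ge0 fn gn A2 B2).
- under eq_esum do rewrite EFinD.
  rewrite esumD; [|by move=> x _; rewrite lee_fin mulr_ge0..].
  by rewrite (prod_ge0 fp gn A1 B2)// (prod_ge0 fn gp A2 B1).
Qed.

(** Half of Fubini for signed families; together with [has_sum_swap] it
    exchanges the order of two summations. The positive and negative parts are
    summed separately; their row sums are finite because each of them is at
    most the total over the product. *)
Lemma has_sum_iter (R : realType) (T U : choiceType) (D : set T) (E : set U)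
    (F : T -> U -> R) (S : R) :
  has_sum (D `*` E) (fun x => F x.1 x.2) S ->
  has_sum D (fun i => sum_over E (F i)) S.
Proof.
have iter (u : T -> U -> R) (a : R) : (forall x y, 0 <= u x y) ->
    \esum_(x in D `*` E) (u x.1 x.2)%:E = a%:E ->
    exists2 v : T -> R,
      (forall x, D x -> \esum_(y in E) (u x y)%:E = (v x)%:E) &
      (forall x, 0 <= v x) /\ \esum_(x in D) (v x)%:E = a%:E.
  move=> u0.
  rewrite -(@esum_esum _ _ _ D (fun=> E) (fun x y => (u x y)%:E)); last first.
    by move=> x y _ _; rewrite lee_fin.
  pose w x : \bar R := \esum_(y in E) (u x y)%:E.
  have w0 x : (0 <= w x)%E by apply: esum_ge0 => y _; rewrite lee_fin.
  move=> wa.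
  have wfin x : D x -> w x \is a fin_num.
    move=> Dx; rewrite fin_num_abs; apply: (summable_pinfty (D := D)) => //.
    rewrite /summable (eq_esum (b := w)) ?wa ?ltry// => y _.
    by rewrite gee0_abs.
  exists (fine \o w) => [x Dx|]; first by rewrite /= fineK ?wfin.
  split=> [x|]; first exact: fine_ge0.
  by rewrite -wa; apply: eq_esum => x Dx; rewrite /= fineK ?wfin.
move=> /has_sumP[[A B] /= -> /= [FA FB]].
have [a aE [a0 aA]] :=
  iter (fun x y => Num.max (F x y) 0) A (fun _ _ => maxr0_ge0 _) FA.
have [b bE [b0 bB]] :=
  iter (fun x y => Num.max (- F x y) 0) B (fun _ _ => maxr0_ge0 _) FB.
apply: (has_sum_decomp (g := a) (h := b)) => // x Dx.
suff [] : has_sum E (F x) (a x - b x) by [].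
apply: (has_sum_decomp _ _ _ (aE _ Dx) (bE _ Dx)) => y _.
- exact: maxr0_ge0.
- exact: maxr0_ge0.
- exact: maxr0_subN.
Qed.

Lemma has_sum_swap (R : realType) (T U : choiceType) (D : set T) (E : set U)
    (F : T -> U -> R) (S : R) :
  has_sum (D `*` E) (fun x => F x.1 x.2) S <->
  has_sum (E `*` D) (fun x => F x.2 x.1) S.
Proof.
apply: iff_sym; apply: (has_sum_reindex _ _ (e := fun x : U * T => (x.2, x.1))).
split=> [[i j] [] //|[i j] [k l] _ _ [-> ->]//|[i j] [/= Di Ej]].
by exists (j, i).
Qed.

(** The Tonelli criterion that feeds [has_sum_iter]. *)
Lemma abs_summable_iter (R : realType) (T U : choiceType) (D : set T)
    (E : set U) (F : T -> U -> R) (g : T -> R) :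
    (forall i, D i -> abs_summable E (F i)) ->
    (forall i, D i -> sum_over E (fun j => `|F i j|) <= g i) ->
    abs_summable D g ->
  abs_summable (D `*` E) (fun x => F x.1 x.2).
Proof.
move=> Fs Fg; apply: le_lt_trans.
rewrite -(@esum_esum _ _ _ D (fun=> E) (fun i j => `|(F i j)%:E|%E))//.
apply: le_esum => i Di.
have Fs' : abs_summable E (fun j => `|F i j|).
  by apply: le_lt_trans (Fs i Di); apply: le_esum => j _ /=; rewrite normr_id.
have : has_sum E (fun j => `|F i j|) (sum_over E (fun j => `|F i j|)) by [].
move=> /has_sum_ge0 /= -> //.
by rewrite lee_fin (le_trans (Fg _ Di))// ler_norm.
Qed.

(** * Closed forms of one-variable series *)

(** For an absolutely summable sequence, the unordered sum is the limit of
    the partial sums, which is how closed forms are reached. *)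
Lemma has_sum_series (R : realType) (f : nat -> R) (S : R) :
  abs_summable setT f -> series f @ \oo --> S -> has_sum setT f S.
Proof.
move=> fs.
have cvg_ge0 (u : nat -> R) (a : R) : (forall n, 0 <= u n) ->
    \esum_(n in setT) (u n)%:E = a%:E -> series u @ \oo --> a.
  move=> u0 ua.
  have su : summable [set x : nat | xpredT x] (EFin \o u).
    rewrite set_true /summable (eq_esum (b := fun n => (u n)%:E)) ?ua ?ltry//.
    by move=> n _ /=; rewrite ger0_norm.
  have u0' n : xpredT n -> (0 <= (EFin \o u) n)%E by move=> _; rewrite lee_fin.
  have := summable_cvg u0' su; have := summable_nneseries_lim u0' su.
  rewrite nneseries_esumT; last by move=> n; rewrite lee_fin.
  by rewrite ua => -[->].
move: (fs) => /abs_summable_has_sum/has_sumP[[A B] /= SE /= [fA fB]] fS.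
split=> //; rewrite SE.
have := cvgB (cvg_ge0 _ _ (fun=> maxr0_ge0 _) fA)
             (cvg_ge0 _ _ (fun=> maxr0_ge0 _) fB).
suff -> : series (fun n => Num.max (f n) 0) -
          series (fun n => Num.max (- f n) 0) = series f.
  move=> /(_ eventually_filter) fAB.
  have hR := @norm_hausdorff _ R.
  by rewrite -(cvg_lim hR fAB) (cvg_lim hR fS).
apply/funext => n; rewrite !fctE /series /= -sumrB.
by apply: eq_bigr => i _; rewrite -maxr0_subN.
Qed.

Lemma has_sum_series_ge0 (R : realType) (f : nat -> R) (S : R) :
  (forall n, 0 <= f n) -> series f @ \oo --> S -> has_sum setT f S.
Proof.
move=> f0 fS; apply/has_sum_ge0 => [n _|]; first exact: f0.
rewrite -nneseries_esumT; last by move=> n; rewrite lee_fin.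
apply/cvg_lim => //.
have -> : (fun n => \sum_(0 <= i < n) (f i)%:E)%E = EFin \o series f.
  by apply/funext => n; rewrite sumEFin.
by apply: cvg_EFin => //; exact: nearW.
Qed.

Lemma has_sum_geometric (R : realType) (z : R) : `|z| < 1 ->
  has_sum setT (fun n => z ^+ n) (1 - z)^-1.
Proof.
have cvgz (w : R) : `|w| < 1 -> series (fun n => w ^+ n) @ \oo --> (1 - w)^-1.
  move=> w1; have := @cvg_geometric_series _ 1 _ w1; rewrite mul1r.
  suff -> : geometric 1 w = (fun n => w ^+ n) by [].
  by apply/funext => n /=; rewrite mul1r.
move=> z1; apply: has_sum_series; last exact: cvgz.
have nz1 : `| `|z| | < 1 by rewrite normr_id.
have [+ _] := has_sum_series_ge0 (fun n => exprn_ge0 n (normr_ge0 z))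
  (cvgz _ nz1).
by apply: abs_summable_le => n _; rewrite normrX.
Qed.

(** Each term is 1/n - 1/(n+1). At n = 0 the term is 0, since 0 is its own
    inverse, so the sum over all naturals is the sum over n >= 1. Up to
    constants, this family dominates all the factors that occur below. *)
Lemma has_sum_telescope (R : realType) :
  has_sum setT (fun n => ((n%:R * n.+1%:R)^-1 : R)) 1.
Proof.
apply: has_sum_series_ge0 => [n|]; first by rewrite invr_ge0 mulr_ge0.
rewrite -cvg_shiftS.
have -> : [sequence series (fun n => ((n%:R * n.+1%:R)^-1 : R)) n.+1]_n =
          cst 1 - @harmonic R.
  apply/funext => n; rewrite !fctE /series /=.
  elim: n => [|n IH]; first by rewrite big_nat1 mul0r invr0 invr1 subrr.
  rewrite big_nat_recr//= IH; field.
  by rewrite -natrD nat1r !pnatr_eq0.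
suff : cst 1 - @harmonic R @ \oo --> (1 - 0 : R) by rewrite subr0.
apply: cvgB; first exact: cvg_cst.
exact: cvg_harmonic.
Qed.

(** * Products and sums over words *)

(** All the summands are products over the letters of a word s matched with
    the entries of q. Both are plain lists: the length of a shifted word is
    only propositionally that of the original, so tuples would require casts. *)
Definition word_prod (R : realType) (T : Type) (F : T -> nat -> R) (s : seq T)
    (q : seq nat) : R := \prod_(p <- zip s q) F p.1 p.2.

Lemma word_prod_cons (R : realType) (T : Type) (F : T -> nat -> R) x s n q :
  word_prod F (x :: s) (n :: q) = F x n * word_prod F s q.
Proof. by rewrite /word_prod /= big_cons. Qed.

Lemma word_prod_nil (R : realType) (T : Type) (F : T -> nat -> R) q :
  word_prod F [::] q = 1.
Proof. by rewrite /word_prod; case: q => [|n q]; rewrite /= big_nil. Qed.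

Lemma word_prod_nilr (R : realType) (T : Type) (F : T -> nat -> R) s :
  word_prod F s [::] = 1.
Proof. by rewrite /word_prod; case: s => [|x s]; rewrite /= big_nil. Qed.

Lemma word_prod_norm (R : realType) (T : Type) (F : T -> nat -> R) s q :
  `|word_prod F s q| = word_prod (fun x n => `|F x n|) s q.
Proof. by rewrite /word_prod normr_prod. Qed.

Lemma word_prod_ge0 (R : realType) (T : Type) (F : T -> nat -> R) s q :
  (forall x n, 0 <= F x n) -> 0 <= word_prod F s q.
Proof. by move=> F0; rewrite /word_prod; apply: prodr_ge0. Qed.

Lemma word_prodM (R : realType) (T : Type) (F G : T -> nat -> R) s q :
  word_prod (fun x n => F x n * G x n) s q = word_prod F s q * word_prod G s q.
Proof. by rewrite /word_prod big_split. Qed.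

Lemma word_prod_le (R : realType) (T : eqType) (F G : T -> nat -> R) s q :
  (forall x n, x \in s -> n \in q -> 0 <= F x n <= G x n) ->
  0 <= word_prod F s q <= word_prod G s q.
Proof.
elim: s q => [|x s IH] [|n q] FG;
  rewrite ?word_prod_nil ?word_prod_nilr ?word_prod_cons ?ler01 ?lexx//.
have /andP[F0 FleG] := FG x n (mem_head _ _) (mem_head _ _).
have /andP[P0 PleQ] : 0 <= word_prod F s q <= word_prod G s q.
  by apply: IH => y m ys mq; apply: FG; rewrite in_cons ?ys ?mq orbT.
by rewrite mulr_ge0//= ler_pM.
Qed.

Lemma eq_word_prod (R : realType) (T : eqType) (F G : T -> nat -> R) s q :
  (forall x n, x \in s -> n \in q -> F x n = G x n) ->
  word_prod F s q = word_prod G s q.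
Proof.
elim: s q => [|x s IH] [|n q] FG;
  rewrite ?word_prod_nil ?word_prod_nilr ?word_prod_cons//.
rewrite FG ?mem_head// IH// => y m ys mq.
by apply: FG; rewrite in_cons ?ys ?mq orbT.
Qed.

Lemma word_prod_const (R : realType) (T : Type) (c : R) (s : seq T) q :
  size q = size s -> word_prod (fun _ _ => c) s q = c ^+ size s.
Proof.
move=> sq; rewrite /word_prod big_const_seq count_predT size_zip sq minnn.
by rewrite -Monoid.iteropE.
Qed.

(** Only the pairing between s and q matters, so rotating both leaves the
    product unchanged. *)
Lemma word_prod_rot (R : realType) (T : eqType) (F : T -> nat -> R) s q i :
  size s = size q -> word_prod F (rot i s) (rot i q) = word_prod F s q.
Proof.
move=> sq.
have E : zip (drop i s ++ take i s) (drop i q ++ take i q) =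
         zip (drop i s) (drop i q) ++ zip (take i s) (take i q).
  by rewrite zip_cat// !size_drop sq.
rewrite /word_prod /rot E; apply: perm_big.
rewrite (perm_catC _ (zip (take i s) _)) -zip_cat ?cat_take_drop//.
by rewrite !size_take sq.
Qed.

Lemma prod_tnth (R : realType) (T : Type) (F : T -> nat -> R) (s : seq T)
    (q : (size s).-tuple nat) :
  \prod_(i < size s) F (tnth (in_tuple s) i) (tnth q i) = word_prod F s q.
Proof.
case: s q => [|x s] q; first by rewrite big_ord0 word_prod_nil.
rewrite /word_prod (big_nth (x, 0%N)) size_zip size_tuple minnn big_mkord.
apply: eq_bigr => i _.
by rewrite nth_zip ?size_tuple//= (tnth_nth x) (tnth_nth 0%N).
Qed.

Lemma mem_zip2 (T : eqType) (s : seq T) (q : seq nat) p :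
  p \in zip s q -> p.1 \in s /\ p.2 \in q.
Proof.
elim: s q => [|x s IH] [|n q]//=; rewrite !inE => /orP[/eqP ->|/IH[-> ->]].
  by rewrite !eqxx.
by rewrite !orbT.
Qed.

Definition words n : set (seq nat) := [set q | size q = n].

Definition increasing_words n : set (seq nat) :=
  [set q | size q = n /\ path ltn 0%N q].

Lemma increasing_words_ge1 d q : increasing_words d q -> all (leq 1%N) q.
Proof.
by move=> [_]; rewrite path_sortedE => [/andP[]//|]; exact: ltn_trans.
Qed.

Lemma has_sum_tuple (R : realType) n (P : set (seq nat)) (f : seq nat -> R)
    (S : R) :
  has_sum [set q : n.-tuple nat | P q] (fun q => f q) S <->
  has_sum [set q : seq nat | size q = n /\ P q] f S.
Proof.
apply: (has_sum_reindex f S (e := @tval n nat)); split.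
- by move=> q /= Pq; split=> //; exact: size_tuple.
- by move=> q r _ _ /val_inj.
- by move=> q [/= /eqP sq Pq]; exists (Tuple sq).
Qed.

(** Distributivity, one letter at a time through [has_sum_prod]. *)
Lemma has_sum_words (R : realType) (T : eqType) (F : T -> nat -> R)
    (A : T -> R) (s : seq T) :
  (forall x, x \in s -> has_sum setT (F x) (A x)) ->
  has_sum (words (size s)) (word_prod F s) (\prod_(x <- s) A x).
Proof.
elim: s => [_|x s IH FA].
  rewrite big_nil; apply/has_sum_ge0 => [q _|].
    by rewrite word_prod_nil ler01.
  have -> : words (size (@nil T)) = [set [::]].
    by apply/seteqP; split=> [q /size0nil//|q ->].
  by rewrite esum_set1 word_prod_nil// lee_fin ler01.
rewrite big_cons.
have Fx := FA x (mem_head _ _).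
have Fs : has_sum (words (size s)) (word_prod F s) (\prod_(x <- s) A x).
  by apply: IH => y ys; apply: FA; rewrite in_cons ys orbT.
pose e (p : nat * seq nat) := p.1 :: p.2.
have be : set_bij (setT `*` words (size s)) (words (size (x :: s))) e.
  split=> [[n q] [_ /= qs]|[n q] [m r] _ _ [-> ->]//|[//|n q] [qs]].
    by rewrite /words /= qs.
  by exists (n, q).
apply/(has_sum_reindex _ _ be); apply: eq_has_sum (has_sum_prod Fx Fs).
by move=> [n q] _; rewrite /= word_prod_cons.
Qed.

(** If each factor is O(1/(n (n+1))), the sum over words with positive
    entries is dominated by a product of convergent one-letter sums. *)
Lemma abs_summable_word_prod (R : realType) (T : eqType) (F : T -> nat -> R)
    (c : R) (s : seq T) (D : set (seq nat)) :
    D `<=` [set q | size q = size s /\ all (leq 1%N) q] ->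
    (forall x n, x \in s -> (1 <= n)%N ->
       `|F x n| <= c * (n%:R * n.+1%:R)^-1) ->
  abs_summable D (word_prod F s).
Proof.
move=> Ds Fc.
apply: (abs_summable_le
  (g := word_prod (fun (_ : T) n => c * (n%:R * n.+1%:R)^-1) s)).
  move=> q /Ds[_ /allP q1]; rewrite word_prod_norm.
  have /word_prod_le/andP[] // : forall x n, x \in s -> n \in q ->
      0 <= `|F x n| <= c * (n%:R * n.+1%:R)^-1.
  by move=> x n xs /q1 n1; rewrite normr_ge0 Fc.
apply: (@sub_abs_summable _ _ _ (words (size s))) => [q /Ds[]//|].
have [] // := @has_sum_words _ _ (fun (_ : T) n => c * (n%:R * n.+1%:R)^-1)
  (fun=> c * 1) s.
by move=> x _; apply: has_sum_mull; exact: has_sum_telescope.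
Qed.

(** * Rearrangements of a list with repetitions *)

(** The normalising factor of C_nu. The bound N is a parameter so that it
    stays fixed when a part is removed from nu in an induction. *)
Definition multiplicity_factorials N (nu : seq nat) : nat :=
  (\prod_(1 <= j < N) (count_mem j nu)`!)%N.

Lemma multiplicity_factorials_rem N y nu : y \in nu -> (1 <= y < N)%N ->
  multiplicity_factorials N nu =
  (count_mem y nu * multiplicity_factorials N (rem y nu))%N.
Proof.
move=> ynu yN; rewrite /multiplicity_factorials.
rewrite [LHS](big_rem y) ?mem_index_iota//=.
rewrite [in RHS](big_rem y) ?mem_index_iota//=.
rewrite count_mem_rem eqxx subn1 mulnA.
have cy : (0 < count_mem y nu)%N by rewrite -has_count has_pred1.
have -> : ((count_mem y nu)`! = count_mem y nu * (count_mem y nu).-1`!)%N.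
  by rewrite -{2}(prednK cy) -factS prednK.
congr (_ * _)%N; rewrite !big_seq; apply: eq_bigr => j.
rewrite mem_rem_uniq ?iota_uniq// inE => /andP[jy _].
by rewrite count_mem_rem eq_sym (negPf jy) subn0.
Qed.

Lemma multiplicity_factorials_perm N s t : perm_eq s t ->
  multiplicity_factorials N s = multiplicity_factorials N t.
Proof.
by move=> /permP st; apply: eq_bigr => j _; rewrite st.
Qed.

(** The rotations of s start once with each of its entries. *)
Lemma sum_head_rotr (R : realType) (G : nat -> R) (s : seq nat) :
  \sum_(i <- iota 0 (size s)) G (head 0%N (rotr i s)) = \sum_(y <- s) G y.
Proof.
case: s => [|x s]; first by rewrite !big_nil.
have -> : iota 0 (size (x :: s)) = index_iota 0 (size s).+1.
  by rewrite /index_iota subn0.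
rewrite big_nat_recl// /rotr subn0 rot_size big_cons /=; congr (_ + _).
rewrite [RHS](big_nth 0%N) [RHS]big_nat_rev/= add0n.
rewrite [LHS]big_nat [RHS]big_nat; apply: eq_bigr => i /andP[_ ilt].
rewrite /= subSS -nth0 /rot nth_cat size_drop /= subn_gt0 ltnS leq_subr.
rewrite nth_drop addn0.
case E : (size s - i)%N => [|k] /=; first by lia.
by congr G; congr nth; lia.
Qed.

(** For distinct q_i, permuting the q_i against a fixed nu amounts to
    permuting the parts of nu against a fixed q, except that each distinct
    arrangement of nu is then met once for every permutation that fixes nu;
    there are prod_j m_j! of these.

    The induction removes the first entry x of q. An arrangement of x :: q is
    a rotation of x :: t with t an arrangement of q; rotating nu back instead
    moves each part y of nu in turn in front of x. Grouping equal parts y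
    produces the multiplicity of y in nu, which is exactly the ratio of the
    factors prod_j m_j! of nu and of nu with one y removed. *)
Lemma sum_permutations_swap (R : realType) (F : nat -> nat -> R) N
    (nu q : seq nat) :
    all (fun j => 1 <= j < N)%N nu -> uniq q -> size nu = size q ->
  \sum_(q' <- permutations q) word_prod F nu q' =
  (multiplicity_factorials N nu)%:R *
  \sum_(sigma <- permutations nu) word_prod F sigma q.
Proof.
elim: q nu => [|x q IH] nu nuN.
  move=> _ /size0nil ->; rewrite /multiplicity_factorials.
  rewrite (_ : permutations [::] = [:: [::]])// !big_seq1 word_prod_nil mulr1.
  by rewrite big1.
move=> /= /andP[xq uq] snu.
(* The contribution of matching x with a part equal to y. *)
pose G y := F y x * (multiplicity_factorials N (rem y nu))%:R *
  \sum_(sigma <- permutations (rem y nu)) word_prod F sigma q.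
transitivity (\sum_(y <- nu) G y).
  rewrite (perm_big _ (permutationsErot _ _)) big_allpairs_dep /=.
  rewrite -sum_head_rotr snu.
  rewrite big_seq (eq_bigr (fun t => \sum_(i <- iota 0 (size q).+1)
      word_prod F (rotr i nu) (x :: t))); last first.
    move=> t; rewrite mem_permutations => tq.
    have xt : x \notin t by rewrite (perm_mem tq).
    rewrite (memNindex xt) addn1 (perm_size tq); apply: eq_bigr => i _.
    by rewrite -{1}(rotrK i nu) word_prod_rot// size_rotr snu /= (perm_size tq).
  rewrite -big_seq exchange_big; apply: eq_bigr => i _ /=.
  have : perm_eq (rotr i nu) nu by rewrite perm_rot.
  case: (rotr i nu) => [/perm_size/=|y nu' pnu /=]; first by rewrite snu.
  under eq_bigr do rewrite word_prod_cons.
  have pnu' : perm_eq nu' (rem y nu).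
    rewrite -(perm_cons y) (permPl pnu) perm_to_rem//.
    by rewrite -(perm_mem pnu) mem_head.
  rewrite -mulr_sumr IH//.
  - rewrite /G (multiplicity_factorials_perm N pnu') mulrA; congr (_ * _).
    exact/perm_big/perm_permutations.
  - by move: nuN; rewrite -(perm_all _ pnu) => /andP[].
  - by have := perm_size pnu; rewrite snu => -[].
have nu0 : (0 < size nu)%N by rewrite snu.
rewrite (perm_big _ (permutationsE nu0)) big_allpairs_dep /= mulr_sumr.
rewrite -[LHS]big_undup_iterop_count big_seq [RHS]big_seq; apply: eq_bigr => y.
rewrite mem_undup => ynu.
rewrite (multiplicity_factorials_rem ynu (allP nuN y ynu)).
under [in RHS]eq_bigr do rewrite word_prod_cons.
rewrite -mulr_sumr Monoid.iteropE iter_addr_0 /G natrM.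
ring.
Qed.

(** * Geometric resummation of a block *)

(** The sum of the geometric series in m with general term
    (-t)^m / n^(k+1+m). *)
Definition resummed_factor (R : realType) (t : R) (k n : nat) : R :=
  (n%:R ^+ k * (n%:R + t))^-1.

Definition resummed_sum (R : realType) (t : R) (s : seq nat) : R :=
  sum_over (increasing_words (size s)) (word_prod (resummed_factor t) s).

(** Negative t matters: for 0 <= t < 1 the factor at -t is the sum of the
    absolute values of the geometric series that the factor at t resums. *)
Lemma abs_summable_resummed (R : realType) (t : R) (s : seq nat) D :
    -1 < t -> all (leq 1%N) s ->
    D `<=` [set q | size q = size s /\ all (leq 1%N) q] ->
  abs_summable D (word_prod (resummed_factor t) s).
Proof.
move=> t1 /allP s1 Ds.
apply: (@abs_summable_word_prod _ _ _ (2 / (1 + t) + 1) s D Ds) => k n /s1 k1 n1.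
have n1R : 1 <= n%:R :> R by rewrite ler1n.
have n0R : 0 < n%:R :> R by rewrite ltr0n.
have nt : 0 < n%:R + t by lra.
have tp : 0 < 1 + t by lra.
rewrite /resummed_factor ger0_norm; last first.
  by rewrite invr_ge0 mulr_ge0 ?exprn_ge0// ltW.
have nk : n%:R <= n%:R ^+ k :> R by rewrite ler_eXnr.
apply: (@le_trans _ _ ((n%:R * (n%:R + t))^-1)).
  rewrite lef_pV2 ?posrE ?mulr_gt0 ?exprn_gt0//.
  by rewrite ler_pM2r.
(* Since n + t = (n - 1) + (1 + t), the bound n + 1 <= c (n + t) holds as soon
   as c >= 1 and c (1 + t) >= 2. *)
pose c := 2 / (1 + t) + 1.
have c1 : 0 <= c - 1 by rewrite /c addrK divr_ge0// ltW.
have ct : c * (1 + t) = 3 + t by rewrite /c; field; rewrite gt_eqF.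
have nc : n%:R + 1 <= c * (n%:R + t).
  have -> : c * (n%:R + t) =
      (c - 1) * (n%:R - 1) + (n%:R - 1) + c * (1 + t) by ring.
  have := mulr_ge0 c1 (_ : 0 <= n%:R - 1).
  by rewrite subr_ge0 ct => /(_ n1R); lra.
rewrite -/c -natr1 ler_pdivlMr ?mulr_gt0 ?ltr_wpDr// mulrC.
rewrite ler_pdivrMr ?mulr_gt0//.
by rewrite mulrCA ler_pM2l.
Qed.

Lemma has_sum_resummed (R : realType) (t : R) k n : `|t| < 1 -> (1 <= n)%N ->
  has_sum setT (fun m => t ^+ m * (n%:R ^+ (k + 1 + m))^-1)
    (resummed_factor (- t) k n).
Proof.
move=> t1 n1.
have n1R : 1 <= n%:R :> R by rewrite ler1n.
have n0R : 0 < n%:R :> R by rewrite ltr0n.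
have z1 : `|t / n%:R| < 1.
  rewrite normrM normfV (ger0_norm (ltW n0R)) ltr_pdivrMr// mul1r.
  exact: lt_le_trans n1R.
have := has_sum_mull (n%:R ^+ (k + 1))^-1 (has_sum_geometric z1).
have -> : (n%:R ^+ (k + 1))^-1 * (1 - t / n%:R)^-1 = resummed_factor (- t) k n.
  rewrite /resummed_factor -invfM addn1 exprSr -mulrA mulrBr mulr1 mulrCA.
  by rewrite mulfV ?mulr1// gt_eqF.
apply: eq_has_sum => m _.
by rewrite expr_div_n (exprD _ (k + 1) m) invfM mulrCA.
Qed.

Lemma size_shift_word sigma m : size m = size sigma ->
  size (shift_word sigma m) = size sigma.
Proof. by move=> sm; rewrite size_map size_zip sm minnn. Qed.

(** The summand of the block, with m and q both explicit, as a product of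
    factors that each involve a single m_i. *)
Lemma word_prod_shift_word (R : realType) (t : R) sigma q m :
    size q = size sigma -> size m = size sigma ->
  word_prod (fun p j => t ^+ j * (p.2%:R ^+ (p.1 + 1 + j))^-1) (zip sigma q) m =
  t ^+ sumn m * word_prod (fun k n => (n%:R ^+ k)^-1) (shift_word sigma m) q.
Proof.
elim: sigma q m => [|k s IH] [|n q] [|j m]//=.
  by rewrite !word_prod_nil mul1r.
move=> [sq] [sm]; rewrite /shift_word /= !word_prod_cons /=.
rewrite -/(shift_word s m) IH//.
by rewrite (exprD t) mulrACA.
Qed.

Lemma mzv_sum (R : realType) (w : seq nat) (S : R) :
  has_sum (@mzv_dom w) (@mzv_term R w) S <->
  has_sum (increasing_words (size w))
    (word_prod (fun k n => (n%:R ^+ k)^-1) w) S.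
Proof.
rewrite -(@has_sum_tuple _ (size w) (path ltn 0%N)).
by split; apply: eq_has_sum => q _;
  rewrite /mzv_term (prod_tnth (fun k n => (n%:R ^+ k)^-1)).
Qed.

(** With all letters at least 2 the factors are at most 1/n^2, hence
    at most 2/(n (n+1)). *)
Lemma abs_summable_mzv (R : realType) (w : seq nat) : all (leq 2%N) w ->
  abs_summable (@mzv_dom w) (@mzv_term R w).
Proof.
move=> /allP w2.
suff /abs_summable_has_sum/mzv_sum[] : abs_summable (increasing_words (size w))
  (word_prod (fun k n => (n%:R ^+ k)^-1 : R) w) by [].
apply: (@abs_summable_word_prod _ _ _ 2) => [q qi|k n /w2 k2 n1].
  by split; [case: qi|exact: increasing_words_ge1 qi].
have n1R : 1 <= n%:R :> R by rewrite ler1n.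
have n0R : 0 < n%:R :> R by rewrite ltr0n.
rewrite ger0_norm; last by rewrite invr_ge0 exprn_ge0.
have nk : n%:R ^+ 2 <= n%:R ^+ k :> R by rewrite ler_weXn2l.
apply: (@le_trans _ _ ((n%:R ^+ 2 : R)^-1)).
  by rewrite lef_pV2 ?posrE ?exprn_gt0.
rewrite -natr1 ler_pdivlMr ?mulr_gt0 ?ltr_wpDr// mulrC ler_pdivrMr ?exprn_gt0//.
rewrite expr2 mulrCA ler_pM2l//; lra.
Qed.

(** Expand each multiple zeta value as a sum over increasing q and exchange
    the two summations. For fixed q the sum over m is a product of geometric
    series of ratios -t/q_i. The exchange is legitimate because the absolute
    values resum to the product of the factors at -t, which is summable in q
    since t < 1. The endpoint t = 1 is excluded by q_1 = 1, where the
    geometric series has ratio of modulus t. *)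
Lemma block_sum (R : realType) (nu sigma : seq nat) (t : R) :
    size sigma = size nu -> all (leq 1%N) sigma -> 0 <= t < 1 ->
  has_sum setT (@block_term R nu sigma t)
    (resummed_sum t sigma).
Proof.
move=> sn s1 /andP[t0 t1]; rewrite /resummed_sum sn.
pose I := increasing_words (size nu); pose W := words (size nu).
have It q : I q -> size q = size sigma /\ all (leq 1%N) q.
  by move=> qI; split; [rewrite sn; case: qI|exact: increasing_words_ge1 qI].
pose F (u : R) (q m : seq nat) :=
  word_prod (fun p j => u ^+ j * (p.2%:R ^+ (p.1 + 1 + j))^-1) (zip sigma q) m.
have szip q : I q -> size (zip sigma q) = size nu.
  by move=> /It[sq _]; rewrite size_zip sq minnn sn.
have Fsum u q : `|u| < 1 -> I q ->
    has_sum W (F u q) (word_prod (resummed_factor (- u)) sigma q).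
  move=> u1 qI; rewrite /W -(szip q qI); apply: has_sum_words => p.
  move=> /mem_zip2[_ pq]; apply: has_sum_resummed => //.
  exact: (allP (It q qI).2).
have nt1 : `|- t| < 1 by rewrite normrN ger0_norm.
have nt1' : `|t| < 1 by rewrite ger0_norm.
(* The absolute values sum over m to the resummed factors at -t. *)
have Fabs : abs_summable (I `*` W) (fun x => F (- t) x.1 x.2).
  apply: (abs_summable_iter (g := word_prod (resummed_factor (- t)) sigma)).
  - by move=> q qI; case: (Fsum (- t) q nt1 qI).
  - move=> q qI; have Ft := Fsum t q nt1' qI.
    suff [_ ->] : has_sum W (fun m => `|F (- t) q m|)
      (word_prod (resummed_factor (- t)) sigma q) by [].
    apply: eq_has_sum Ft => m _; rewrite word_prod_norm.
    apply: eq_word_prod => p j _ _.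
    by rewrite normrM normrX normrN ger0_norm// ger0_norm// invr_ge0.
  - by apply: abs_summable_resummed => //; rewrite ltrNl opprK.
have FE : sum_over I (fun q => sum_over W (F (- t) q)) =
          sum_over I (word_prod (resummed_factor t) sigma).
  suff [] : has_sum I (fun q => sum_over W (F (- t) q))
    (sum_over I (word_prod (resummed_factor t) sigma)) by [].
  apply: (@eq_has_sum _ _ _ (word_prod (resummed_factor t) sigma)) => [q qI|].
    by have [_ ->] := Fsum (- t) q nt1 qI; rewrite opprK.
  split=> //; apply: abs_summable_resummed => //.
  by rewrite (lt_le_trans _ t0)// ltrN10.
have : has_sum W (fun m => (- t) ^+ sumn m * mzv R (shift_word sigma m))
    (sum_over I (word_prod (resummed_factor t) sigma)).
  have [_ /esym E] := has_sum_iter (abs_summable_has_sum Fabs).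
  rewrite -FE -E.
  have /has_sum_swap := abs_summable_has_sum Fabs.
  move=> /(has_sum_iter (F := fun m q => F (- t) q m)).
  apply: eq_has_sum => m mW; have sm : size m = size sigma by rewrite sn.
  have sw := size_shift_word sm.
  pose w := shift_word sigma m.
  have /mzv_sum : has_sum (@mzv_dom w) (@mzv_term R w) (mzv R w).
    split=> //; apply: abs_summable_mzv; apply/allP => k /mapP[p pz ->].
    have [/(allP s1)/= p1 _] := mem_zip2 pz.
    by rewrite addn1 addSn ltnS ltn_addr.
  rewrite sw sn => /(has_sum_mull ((- t) ^+ sumn m)) mE.
  suff [] : has_sum I (fun q => F (- t) q m)
    ((- t) ^+ sumn m * mzv R w) by [].
  apply: eq_has_sum mE => q qI; rewrite /F word_prod_shift_word//.
  by case: (It q qI).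
have -> : W = [set q | size q = size nu /\ [set: seq nat] q].
  by apply/seteqP; split=> [q|q []].
by move/(@has_sum_tuple _ (size nu) setT).
Qed.

(** * The Abel limit *)

Lemma ltrN11 (R : numDomainType) : -1 < 1 :> R.
Proof. exact: lt_trans (ltrN10 R) ltr01. Qed.

Lemma has_sum_resummed_words (R : realType) (t : R) (s : seq nat) :
    -1 < t -> all (leq 1%N) s ->
  has_sum (increasing_words (size s)) (word_prod (resummed_factor t) s)
    (resummed_sum t s).
Proof.
move=> t1 s1; split=> //; apply: abs_summable_resummed => // q qI.
by split; [case: qI|exact: increasing_words_ge1 qI].
Qed.

(** The ratio (n+1)/(n+t) decreases in n from 2/(1+t) to 1. *)
Lemma resummed_factor_squeeze (R : realType) (t : R) k n :
    0 <= t <= 1 -> (1 <= n)%N ->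
  0 <= resummed_factor (1 : R) k n <= resummed_factor t k n /\
  0 <= resummed_factor t k n <= 2 / (1 + t) * resummed_factor (1 : R) k n.
Proof.
move=> /andP[t0 t1] n1.
have n1R : 1 <= n%:R :> R by rewrite ler1n.
have n0R : 0 < n%:R :> R by rewrite ltr0n.
have n1p : 0 < n%:R + 1 :> R by lra.
have ntp : 0 < n%:R + t :> R by lra.
have tp : 0 < 1 + t by lra.
have f0 (u : R) : 0 < n%:R + u -> 0 <= resummed_factor u k n.
  by move=> u0; rewrite /resummed_factor invr_ge0 ltW// mulr_gt0 ?exprn_gt0.
rewrite !f0// /resummed_factor !invfM mulrCA; split=> /=;
  rewrite ler_pM2l ?invr_gt0 ?exprn_gt0//.
  by rewrite lef_pV2 ?posrE//; lra.
rewrite ler_pdivlMr// mulrC ler_pdivrMr// mulrAC ler_pdivlMr//.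
rewrite mulrDl mulrDr !mul1r mulr1.
have := mulr_ge0 (_ : 0 <= n%:R - 1) (_ : 0 <= 1 - t).
by rewrite !subr_ge0 => /(_ n1R t1); lra.
Qed.

(** The bounds on a single factor are uniform in n, so they survive the
    product and the summation; this replaces a dominated convergence
    argument. *)
Lemma resummed_sum_squeeze (R : realType) (t : R) (s : seq nat) :
    0 <= t <= 1 -> all (leq 1%N) s ->
  resummed_sum (1 : R) s <= resummed_sum t s <=
  (2 / (1 + t)) ^+ size s * resummed_sum (1 : R) s.
Proof.
move=> t01 s1; have /andP[t0 _] := t01.
have h1 := has_sum_resummed_words (ltrN11 R) s1.
have ht := has_sum_resummed_words (lt_le_trans (ltrN10 R) t0) s1.
have inc q n : increasing_words (size s) q -> n \in q -> (1 <= n)%N.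
  by move=> /increasing_words_ge1/allP; apply.
apply/andP; split.
  apply: (has_sum_le _ h1 ht) => q qI; apply: word_prod_le => k n _ nq.
  by have [] := resummed_factor_squeeze k t01 (inc q n qI nq).
apply: (has_sum_le _ ht (has_sum_mull _ h1)) => q qI.
have sq : size q = size s by case: qI.
rewrite -(word_prod_const (2 / (1 + t)) sq) -word_prodM.
apply: word_prod_le => k n _ nq.
by have [] := resummed_factor_squeeze k t01 (inc q n qI nq).
Qed.

Lemma cvg_resummed_sum (R : realType) (s : seq nat) : all (leq 1%N) s ->
  resummed_sum t s @[t --> (1 : R)^'-] --> resummed_sum (1 : R) s.
Proof.
move=> s1; set L := resummed_sum (1 : R) s.
have c : (2 / (1 + t)) ^+ size s * L @[t --> (1 : R)^'-] --> L.
  apply: cvg_at_left_filter.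
  have {2}-> : L = (2 / (1 + 1)) ^+ size s * L.
    by rewrite divff ?expr1n ?mul1r// pnatr_eq0.
  have e : 2 / (1 + t) @[t --> (1 : R)] --> (2 / (1 + 1) : R).
    apply: cvgM; first exact: cvg_cst.
    apply: cvgV; first by rewrite gt_eqF.
    by apply: cvgD; [exact: cvg_cst|exact: cvg_id].
  apply: cvgM; last exact: cvg_cst.
  exact: (continuous_cvg _ (@exprn_continuous R _ _) e).
apply: (squeeze_cvgr _ (cvg_cst L) c).
near=> t.
apply: resummed_sum_squeeze => //.
apply/andP; split; apply: ltW; near: t; first exact: nbhs_left_gt.
exact: nbhs_left_lt.
Unshelve. all: by end_near. Qed.

(** * The sum over distinct integers *)

Lemma C_sum (R : realType) (nu : seq nat) (S : R) :
  has_sum (@C_dom nu) (@C_term R nu) S <->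
  has_sum [set q | size q = size nu /\ all (leq 1%N) q && uniq q]
    (word_prod (a_coef R) nu) S.
Proof.
rewrite -(@has_sum_tuple _ (size nu) (fun q => all (leq 1%N) q && uniq q)).
by split; apply: eq_has_sum => q _; rewrite /C_term prod_tnth.
Qed.

(** Tuples of distinct positive integers are grouped by their increasing
    rearrangement. *)
Lemma esum_arrangements (R : realType) d (f : seq nat -> R) :
    (forall q, 0 <= f q) ->
  \esum_(q in [set q | size q = d /\ all (leq 1%N) q && uniq q]) (f q)%:E =
  \esum_(q in increasing_words d) (\sum_(q' <- permutations q) f q')%:E.
Proof.
move=> f0; transitivity (\esum_(q in increasing_words d)
    \esum_(q' in [set` permutations q]) (f q')%:E); last first.
  apply: eq_esum => q _.
  have fin : finite_set [set` permutations q] by exact: finite_seq.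
  rewrite esum_fset//; last by move=> q' _; rewrite lee_fin.
  by rewrite -(fsbig_seq _ _ (permutations_uniq q)) sumEFin.
rewrite esum_esum; last by move=> *; rewrite lee_fin.
apply: (reindex_esum _ _ snd); split.
- move=> [q q'] [/= [sq pq]] /=; rewrite mem_permutations => q'q.
  move: pq; rewrite path_sortedE; last exact: ltn_trans.
  rewrite ltn_sorted_uniq_leq => /and3P[q1 uq _].
  by rewrite (perm_size q'q) (perm_all _ q'q) (perm_uniq q'q) q1 uq.
- move=> [q1 q1'] [q2 q2'] /set_mem[/= [_ pq1]] /= +.
  move=> + /set_mem[/= [_ pq2]] /= + /= qq.
  rewrite -qq !mem_permutations => p1 p2; congr (_, _).
  apply: (irr_sorted_eq ltn_trans ltnn (path_sorted pq1) (path_sorted pq2)).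
  by apply: perm_mem; rewrite -(permPl p1).
- move=> q [/= sq /andP[q1 uq]]; exists (sort leq q, q) => //; split=> /=.
    split; first by rewrite size_sort.
    rewrite path_sortedE; last exact: ltn_trans.
    rewrite ltn_sorted_uniq_leq sort_uniq uq (sort_sorted leq_total).
    by rewrite (perm_all _ (permEl (perm_sort _ _))) q1.
  by rewrite mem_permutations perm_sym perm_sort.
Qed.

Lemma a_coef_resummed (R : realType) k n :
  a_coef R k n = ((k.+1)`!%:R)^-1 * resummed_factor 1 k n.
Proof. by rewrite /a_coef /resummed_factor -natr1 -mulrA invfM. Qed.

(** Sort each tuple of distinct integers, and use [sum_permutations_swap] to
    let the parts of nu be permuted instead of the integers. *)
Lemma C_part_sum (R : realType) (nu : seq nat) : all (leq 1%N) nu ->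
  has_sum (@C_dom nu) (@C_term R nu)
    ((multiplicity_factorials (sumn nu).+1 nu)%:R *
     ((\prod_(k <- nu) (k.+1)`!)%N%:R^-1 *
      \sum_(sigma <- permutations nu) resummed_sum (1 : R) sigma)).
Proof.
move=> nu1; apply/C_sum.
have a0 k n : 0 <= a_coef R k n by rewrite /a_coef invr_ge0 !mulr_ge0 ?exprn_ge0.
apply/has_sum_ge0 => [q _|]; first exact: word_prod_ge0.
rewrite esum_arrangements; last by move=> q; exact: word_prod_ge0.
set M := multiplicity_factorials _ _.
set K := (\prod_(k <- nu) _)%N.
transitivity (\esum_(q in increasing_words (size nu))
  \sum_(sigma <- permutations nu)
    ((M%:R * (K%:R^-1 * word_prod (resummed_factor (1 : R)) sigma q)) : R)%:E).
  apply: eq_esum => q [sq pq]; rewrite sumEFin -mulr_sumr -mulr_sumr; congr EFin.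
  rewrite (@sum_permutations_swap _ _ (sumn nu).+1)//.
  - rewrite -/M mulr_sumr; congr (_ * _); rewrite big_seq [RHS]big_seq.
    apply: eq_bigr => sigma; rewrite mem_permutations => sn.
    have -> : word_prod (a_coef R) sigma q = word_prod
        (fun k n => ((k.+1)`!%:R)^-1 * resummed_factor (1 : R) k n) sigma q.
      by apply: eq_word_prod => k n _ _; exact: a_coef_resummed.
    rewrite word_prodM; congr (_ * _).
    rewrite /word_prod (eq_bigr (fun p => (p.1.+1)`!%:R^-1))//.
    rewrite -(big_map fst xpredT (fun k => (k.+1)`!%:R^-1)) -/(unzip1 _).
    rewrite unzip1_zip; last by rewrite sq (perm_size sn).
    by rewrite prodfV -natr_prod /K (perm_big _ sn).
  - apply/allP => j jnu; rewrite (allP nu1 _ jnu) ltnS.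
    by rewrite (perm_sumn (perm_to_rem jnu)) leq_addr.
  - move: pq; rewrite path_sortedE; last exact: ltn_trans.
    by rewrite ltn_sorted_uniq_leq => /and3P[].
have k0 k n : 0 <= resummed_factor (1 : R) k n.
  by rewrite /resummed_factor invr_ge0 mulr_ge0 ?exprn_ge0 ?addr_ge0.
rewrite esum_sum; last first.
  by move=> q sigma _ _; rewrite lee_fin !mulr_ge0 ?invr_ge0// word_prod_ge0.
rewrite !mulr_sumr -sumEFin big_seq [RHS]big_seq; apply: eq_bigr => sigma.
rewrite mem_permutations => sn.
have s1 : all (leq 1%N) sigma by rewrite (perm_all _ sn).
have /(has_sum_mull K%:R^-1)/(has_sum_mull M%:R) :=
  has_sum_resummed_words (ltrN11 R) s1.
rewrite (perm_size sn); move=> /has_sum_ge0; apply=> q _.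
by rewrite !mulr_ge0 ?invr_ge0// word_prod_ge0.
Qed.

(** * The limit formula *)

Theorem theorem7p5 (R : realType) (r : nat) (hr : (2 <= r)%N)
    (nu : seq nat) (hnu : is_partition (r - 1) nu) :
  [/\ (* the sum defining C_nu converges absolutely *)
      abs_summable (@C_dom nu) (@C_term R nu),
      (* so does every multiple zeta value occurring in the block *)
      (forall w : seq nat, block_words nu w ->
         abs_summable (@mzv_dom w) (@mzv_term R w)),
      (* and so does every inner series for 0 <= t < 1 *)
      (forall (sigma : seq nat) (t : R), sigma \in permutations nu ->
         0 <= t < 1 -> abs_summable setT (@block_term R nu sigma t)),
      block nu t @[t --> (1 : R)^'-] --> C_part R nu &
      forall w : seq nat, block_words nu w -> mzv_depth w = size nu].
Proof.
have nu1 : all (leq 1%N) nu by case/and3P: hnu.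
have perm1 sigma : sigma \in permutations nu ->
    all (leq 1%N) sigma /\ size sigma = size nu.
  by rewrite mem_permutations => sn; rewrite (perm_all _ sn) (perm_size sn).
split.
- by case: (C_part_sum R nu1).
- move=> w [sigma /perm1[/allP s1 _] [m ->]]; apply: abs_summable_mzv.
  apply/allP => k /mapP[p pz ->].
  by have [/s1/= p1 _] := mem_zip2 pz; rewrite addn1 addSn ltnS ltn_addr.
- by move=> sigma t /perm1[s1 sn] t01; case: (block_sum sn s1 t01).
- set L := (\prod_(k <- nu) (k.+1)`!)%N%:R^-1 *
      \sum_(sigma <- permutations nu) resummed_sum (1 : R) sigma.
  (* The multiplicities in C_nu cancel those produced by the rearrangement. *)
  have -> : C_part R nu = L.
    have [_ CE] := C_part_sum R nu1.
    rewrite /C_part CE -/L mulKf// pnatr_eq0 -lt0n prodn_gt0// => j.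
    exact: fact_gt0.
  have bE t : 0 <= t < 1 -> block nu t = (\prod_(k <- nu) (k.+1)`!)%N%:R^-1 *
      \sum_(sigma <- permutations nu) resummed_sum t sigma.
    move=> t01; congr (_ * _); rewrite big_seq [RHS]big_seq.
    by apply: eq_bigr => sigma /perm1[s1 sn]; have [_] := block_sum sn s1 t01.
  have cvgL : (\prod_(k <- nu) (k.+1)`!)%N%:R^-1 *
      \sum_(sigma <- permutations nu) resummed_sum t sigma
      @[t --> (1 : R)^'-] --> L.
    apply: cvgM; first exact: cvg_cst.
    rewrite big_seq; under eq_fun do rewrite big_seq.
    apply: cvg_big => [|sigma /perm1[s1 sn]]; first exact: add_continuous.
    exact: cvg_resummed_sum.
  apply: cvg_trans cvgL; apply: near_eq_cvg; near=> t.
  rewrite bE//; apply/andP; split; last by near: t; exact: nbhs_left_lt.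
  by apply: ltW; near: t; exact: nbhs_left_gt.
- move=> w [sigma /perm1[_ sn] [m ->]].
  by rewrite /mzv_depth size_shift_word// size_tuple.
Unshelve. all: by end_near. Qed.
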